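(* Let $X$ be a dyadic set with a binary set system whose non-leaf sets are $\mathcal{B}$, and let $\mathcal{B}_n\subseteq\mathcal{B}$ denote the non-leaf dyadic sets at distance at most $n$ from the root $X$. 1. If $\mu$ is a positive measure on $X$ with product coefficients $a_S$, $S\in\mathcal{B}$, then the weak-star limit, denoted $\mu(X)\prod_{S\in\mathcal{B}}(1+a_Sh_S)\,dy$, of the partial product measures $$\mu_n=\mu(X)\prod_{S\in\mathcal{B}_n}(1+a_Sh_S)\,dy$$ exists, and $$\mu=\mu(X)\prod_{S\in\mathcal{B}}(1+a_Sh_S)\,dy .$$ 2. For any assignment of parameters $a_S\in(-1,1)$, $S\in\mathcal{B}$, and any choice of a number $\mu(X)>0$, the weak-star limit $\mu(X)\prod_{S\in\mathcal{B}}(1+a_Sh_S)\,dy$ of the partial product measures $\mu_n=\mu(X)\prod_{S\in\mathcal{B}_n}(1+a_Sh_S)\,dy$ exists. The limit measure is positive on all sets $S$ in the binary set system (it assigns strictly positive measure to each of them); its product coefficients are the parameters $a_S$, and its total mass (expected value) is $\mu(X)$. 3. For any assignment of parameters $a_S\in[-1,1]$, $S\in\mathcal{B}$, and any choice of a number $\mu(X)>0$, the weak-star limit $\mu(X)\prod_{S\in\mathcal{B}}(1+a_Sh_S)\,dy$ of the partial product measures $\mu_n=\mu(X)\prod_{S\in\mathcal{B}_n}(1+a_Sh_S)\,dy$ exists. The limit measure is a positive measure, and its total mass (expected value) is $\mu(X)$. If, moreover, the parameters are assigned using the convention that whenever a half ($L(S)$ or $R(S)$) of a set $S$ in the binary set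 system has measure zero, the value zero is assigned to the parameters of that half and of all its descendants, then the parameters $a_S$ are the product coefficients of the limit measure.
   Context: **Dyadic set.** A dyadic set $X$ is a set with an ordered binary set system: a (finite or infinite) collection of subsets of $X$ forming a rooted binary tree with root $X$, in which every non-leaf (parent) set $S$ is the disjoint union of an ordered pair of child sets, its left child $L(S)$ and its right child $R(S)$. The sets in the system are nonempty. They are called the dyadic sets of $X$. Every dyadic set is at finite distance (depth) from the root. **Positive measures.** A positive measure $\mu$ on (the sigma algebra generated by the binary set system of) $X$ is regarded as determined by, and identified with, a finite non-negative additive function on the sets of the binary set system, i.e. $\mu(S)\ge 0$ and $\mu(L(S))+\mu(R(S))=\mu(S)$ for every non-leaf $S$, with $\mu(X)>0$. (So ''positive measure'' permits individual sets of measure $0$.) The total mass of $\mu$ is $\mu(X)$, also called its expected value. Two measures are equal when they agree on all dyadic sets. The weak-star limit of a sequence of measures $\mu_n$ is the measure $\mu$ with $\mu(S)=\lim_n\mu_n(S)$ for every dyadic set $S$. **Naive measure.** $dy$ is the measure with $dy(X)=1$ and $dy(L(S))=dy(R(S))=\frac12 dy(S)$ for every non-leaf $S$. **Haar-like functions.** For a non-leaf set $S$, $h_S:X\to\mathbb{R}$ is $1$ on $L(S)$, $-1$ on $R(S)$, and $0$ on $X\setminus S$. **Partial products.** The function $\prod_{S\in\mathcal{B}_n}(1+a_Sh_S)$ is constant on each dyadic set at depth $n+1$ and on each leaf of smaller depth. The measure $\prod_{S\in\mathcal{B}_n}(1+a_Sh_S)\,dy$ assigns to a dyadic set the integral of this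 simple function over that set with respect to $dy$. **Product coefficients.** For a positive measure $\mu$ and a non-leaf set $S$, the product coefficient $a_S$ is the solution of $$\mu(L(S))=\tfrac12(1+a_S)\mu(S),\qquad \mu(R(S))=\tfrac12(1-a_S)\mu(S).$$ If $\mu(S)\ne0$ the solution is unique. If $\mu(S)=0$, the convention is $a_S=0$ (equivalently: whenever one of the two parts of a dyadic set has measure zero, the product coefficients of that part and of all its descendants are zero). *)

(* Defs.v *)
From mathcomp Require Import all_boot all_order all_algebra.
From mathcomp Require Import all_classical all_reals all_analysis.

Set Implicit Arguments.
Unset Strict Implicit.
Unset Printing Implicit Defensive.

Import Order.TTheory GRing.Theory Num.Theory.
Import numFieldNormedType.Exports.

Local Open Scope classical_set_scope.
Local Open Scope ring_scope.

(* The sets lying exactly n levels below S, when each set of [B] is split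
   by [l] and [r]. *)
Fixpoint generation (X : Type) (B : set (set X)) (l r : set X -> set X)
    (S : set X) (n : nat) : set (set X) :=
  match n with
  | 0 => [set S]
  | n'.+1 => [set T | exists P, [/\ generation B l r S n' P, B P
                                  & T = l P \/ T = r P]]
  end.

(* [lchild] and [rchild] are total functions, but their values matter only on
   non-leaf sets.  Since children are disjoint and nonempty, distinct nodes of
   the tree are distinct subsets of X. *)
Record dyadic_system (X : Type) := DyadicSystem {
  dyadic : set (set X);
  nonleaf : set (set X);
  lchild : set X -> set X;
  rchild : set X -> set X;
  dyadic_root : dyadic [set: X];
  nonleaf_dyadic : nonleaf `<=` dyadic;
  dyadic_nonempty : forall S, dyadic S -> S !=set0;
  lchild_dyadic : forall S, nonleaf S -> dyadic (lchild S);
  rchild_dyadic : forall S, nonleaf S -> dyadic (rchild S);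
  childU : forall S, nonleaf S -> lchild S `|` rchild S = S;
  childI : forall S, nonleaf S -> lchild S `&` rchild S = set0;
  dyadic_finite_depth : forall S, dyadic S ->
    exists n, generation nonleaf lchild rchild [set: X] n S }.

Definition level (X : Type) (D : dyadic_system X) (S : set X) (n : nat) :=
  generation (nonleaf D) (lchild D) (rchild D) S n.

(* S itself is included. *)
Definition descendants (X : Type) (D : dyadic_system X) (S : set X) :
    set (set X) :=
  \bigcup_n level D S n.

Definition leaf (X : Type) (D : dyadic_system X) : set (set X) :=
  dyadic D `\` nonleaf D.

Definition depth (X : Type) (D : dyadic_system X) (S : set X) : nat :=
  xget 0%N [set n | level D [set: X] n S].

Definition nonleaf_upto (X : Type) (D : dyadic_system X) (n : nat) :
    set (set X) :=
  [set S | nonleaf D S /\ (depth D S <= n)%N].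

Section measures.
Variables (R : realType) (X : Type) (D : dyadic_system X).

(* A measure is a set function of which only the values on the dyadic sets are
   relevant; no countable additivity is involved, as the branches of the tree
   may have empty intersection. *)
Definition finite_additive (mu : set X -> R) : Prop :=
  (forall S, dyadic D S -> 0 <= mu S) /\
  (forall S, nonleaf D S -> mu (lchild D S) + mu (rchild D S) = mu S).

Definition positive_measure (mu : set X -> R) : Prop :=
  finite_additive mu /\ 0 < mu [set: X].

Definition measure_eq (mu nu : set X -> R) : Prop :=
  forall S, dyadic D S -> mu S = nu S.

(* See [naive_root], [naive_lchild] and [naive_rchild] below. *)
Definition naive (S : set X) : R := 2^-1 ^+ depth D S.

Definition haar (S : set X) (x : X) : R :=
  if x \in lchild D S then 1 else if x \in rchild D S then -1 else 0.

Definition partial_product (a : set X -> R) (n : nat) (x : X) : R :=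
  \big[*%R/1]_(S \in nonleaf_upto D n) (1 + a S * haar S x).

(* The finite dyadic partition of X on whose parts [partial_product a n] is
   constant. *)
Definition cells (n : nat) : set (set X) :=
  [set S | dyadic D S /\
           (depth D S = n.+1 \/ leaf D S /\ (depth D S <= n)%N)].

(* The partition of T induced by [cells n]; it is just T when T is contained
   in a cell. *)
Definition pieces (n : nat) (T : set X) : set (set X) :=
  [set P | P !=set0 /\ exists2 C, cells n C & P = C `&` T].

(* The integral over the dyadic set T, with respect to nu, of a function f that
   is constant on each set of [cells n]; [xget 0 (f @` P)] is the value taken
   by f on P. *)
Definition simple_integral (nu : set X -> R) (n : nat) (f : X -> R)
    (T : set X) : R :=
  \sum_(P \in pieces n T) xget 0 (f @` P) * nu P.

Definition partial_product_measure (m : R) (a : set X -> R) (n : nat)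
    (T : set X) : R :=
  m * simple_integral naive n (partial_product a n) T.

Definition is_weak_star_limit (mu_ : nat -> set X -> R) (mu : set X -> R) :
    Prop :=
  finite_additive mu /\
  forall S, dyadic D S -> (fun n => mu_ n S) @ \oo --> mu S.

(* Meaningful only when the limits exist: statements about it should come with
   [is_weak_star_limit]. *)
Definition product_measure (m : R) (a : set X -> R) (S : set X) : R :=
  limn (fun n => partial_product_measure m a n S).

Definition product_coefficients (mu a : set X -> R) : Prop :=
  forall S, nonleaf D S ->
    [/\ mu (lchild D S) = 2^-1 * (1 + a S) * mu S,
        mu (rchild D S) = 2^-1 * (1 - a S) * mu S
      & mu S = 0 -> a S = 0].

Definition zero_convention (mu a : set X -> R) : Prop :=
  forall S H, nonleaf D S -> H = lchild D S \/ H = rchild D S -> mu H = 0 ->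
  forall T, descendants D H T -> nonleaf D T -> a T = 0.

End measures.

Section depth_theory.
Variables (X : Type) (D : dyadic_system X).

Lemma child_sub (S T : set X) : nonleaf D S ->
  T = lchild D S \/ T = rchild D S -> T `<=` S.
Proof.
move=> nS [] -> x cx; rewrite -(childU nS); first by left.
by right.
Qed.

Lemma child_dyadic (S T : set X) : nonleaf D S ->
  T = lchild D S \/ T = rchild D S -> dyadic D T.
Proof. by move=> nS [] ->; [exact: lchild_dyadic|exact: rchild_dyadic]. Qed.

Lemma level_dyadic (n : nat) (S : set X) : level D [set: X] n S -> dyadic D S.
Proof.
case: n => [->|n [P [_ nP SP]]]; first exact: dyadic_root.
exact: child_dyadic nP SP.
Qed.

Lemma level_inj (n : nat) (S T : set X) : level D [set: X] n S ->
  level D [set: X] n T -> S `&` T !=set0 -> S = T.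
Proof.
elim: n S T => [S T -> ->//|n IH S T [P [lP nP SP]] [Q [lQ nQ TQ]] [x [Sx Tx]]].
have PQ : P = Q.
  apply: IH => //; exists x; split.
    exact: child_sub nP SP _ Sx.
  exact: child_sub nQ TQ _ Tx.
subst Q.
case: SP TQ Sx Tx => -> [] -> // Sx Tx.
  by have : set0 x by rewrite -(childI nP).
by have : set0 x by rewrite -(childI nP).
Qed.

Lemma level_lt (n k : nat) (S : set X) : level D [set: X] n S ->
  level D [set: X] (n + k.+1) S -> False.
Proof.
move=> lS.
suff H j T : level D [set: X] (n + j) T -> T `&` S !=set0 ->
    T `<=` S /\ ((0 < j)%N -> ~ S `<=` T).
  move=> lS'; have [x Sx] := dyadic_nonempty (level_dyadic lS).
  by have [_ /(_ isT)] := H _ _ lS' (ex_intro _ x (conj Sx Sx)); apply.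
elim: j T => [|j IH] T.
  by rewrite addn0 => lT /(level_inj lT lS) ->; split=> // x.
rewrite addnS => -[P [lP nP TP]] [x [Tx Sx]].
have TsP := child_sub nP TP.
have [PS _] := IH P lP (ex_intro _ x (conj (TsP _ Tx) Sx)).
split=> [|_ ST]; first exact: subset_trans TsP PS.
have PT : P `<=` T by exact: subset_trans PS ST.
case: TP PT => -> PT.
  have [y ry] := dyadic_nonempty (rchild_dyadic nP).
  have Py : P y by exact: child_sub nP (or_intror erefl) _ ry.
  by have : set0 y by rewrite -(childI nP); split=> //; exact: PT.
have [y ry] := dyadic_nonempty (lchild_dyadic nP).
have Py : P y by exact: child_sub nP (or_introl erefl) _ ry.
by have : set0 y by rewrite -(childI nP); split=> //; exact: PT.
Qed.

Lemma depthE (n : nat) (S : set X) : level D [set: X] n S -> depth D S = n.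
Proof.
rewrite /depth => lS; case: xgetP => [m _ /= lmS|/(_ n)//].
case: (ltngtP m n) => [mn|nm|//].
- have e : n = (m + (n - m).-1.+1)%N by rewrite prednK ?subn_gt0// subnKC// ltnW.
  by case: (@level_lt m (n - m).-1 S lmS); rewrite -e.
- have e : m = (n + (m - n).-1.+1)%N by rewrite prednK ?subn_gt0// subnKC// ltnW.
  by case: (@level_lt n (m - n).-1 S lS); rewrite -e.
Qed.

Lemma depth_child (S T : set X) : nonleaf D S ->
  T = lchild D S \/ T = rchild D S -> depth D T = (depth D S).+1.
Proof.
move=> nS TS; have [n lS] := dyadic_finite_depth (nonleaf_dyadic nS).
by rewrite (depthE lS); apply: depthE; exists S.
Qed.

Variable R : realType.

Lemma naive_root : naive R D [set: X] = 1.
Proof. by rewrite /naive (@depthE 0). Qed.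

Lemma naive_lchild (S : set X) : nonleaf D S ->
  naive R D (lchild D S) = 2^-1 * naive R D S.
Proof. by move=> nS; rewrite /naive (depth_child nS (or_introl erefl)) exprS. Qed.

Lemma naive_rchild (S : set X) : nonleaf D S ->
  naive R D (rchild D S) = 2^-1 * naive R D S.
Proof. by move=> nS; rewrite /naive (depth_child nS (or_intror erefl)) exprS. Qed.

End depth_theory.

(* Main.v *)
(* A dyadic set at depth k is a union of cells of the n-th partial product as
   soon as k <= n + 1; splitting it repeatedly into children, the factors
   1 + a and 1 - a of its descendants average out to 1, so the n-th partial
   product measure does not depend on n >= k.  Hence the weak-star limit is a
   pointwise eventually constant limit, and it satisfies the recursion that
   characterises product coefficients. *)
Require Import Defs.
From mathcomp Require Import all_boot all_order all_algebra.
From mathcomp Require Import all_classical all_reals all_analysis.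
From mathcomp Require Import ring lra.

Import Order.TTheory GRing.Theory Num.Theory.
Import numFieldNormedType.Exports.

Local Open Scope classical_set_scope.
Local Open Scope ring_scope.

(** * Ancestors and nesting in the dyadic tree *)

Section tree.
Context {X : Type} {D : dyadic_system X}.

Lemma level_depth {S : set X} : dyadic D S -> level D [set: X] (depth D S) S.
Proof. by move=> /dyadic_finite_depth[n lS]; rewrite (depthE lS). Qed.

Lemma dyadic_ind (P : set X -> Prop) :
  P [set: X] ->
  (forall S, nonleaf D S -> P S -> P (lchild D S) /\ P (rchild D S)) ->
  forall S, dyadic D S -> P S.
Proof.
move=> PX Pchild S /dyadic_finite_depth[n]; elim: n S => [S ->//|n IH S].
by move=> [Q [lQ nQ SQ]]; have [] := Pchild Q nQ (IH Q lQ); case: SQ => ->.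
Qed.

(** The guard [0 < j] matters: for [j = 0] the ancestor is [S] itself, which may be a leaf. *)
Lemma ancestor {k j : nat} {S : set X} : level D [set: X] (k + j) S ->
  exists P, [/\ level D [set: X] k P, S `<=` P & (0 < j)%N -> nonleaf D P].
Proof.
elim: j S => [|j IH] S; first by rewrite addn0 => lS; exists S; split.
rewrite addnS => -[Q [lQ nQ SQ]].
have [P [lP QP jP]] := IH Q lQ; exists P; split => //.
  exact: subset_trans (child_sub nQ SQ) QP.
move=> _; case: j lQ jP {IH} => [|j _]; last exact.
rewrite addn0 => lQ _; suff -> : P = Q by [].
apply: (level_inj lP lQ); have [x Qx] := dyadic_nonempty (level_dyadic lQ).
by exists x; split=> //; exact: QP.
Qed.

(** The ancestor of [S] at the depth of [T] meets [T], so it equals [T] by [level_inj]; having a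
    proper descendant, it has been split. *)
Lemma deeper_nonleaf {S T : set X} : dyadic D S -> dyadic D T ->
  (depth D T < depth D S)%N -> S `&` T !=set0 -> nonleaf D T.
Proof.
move=> /level_depth lS /level_depth lT TS [x [Sx Tx]].
have := @ancestor (depth D T) (depth D S - depth D T) S.
rewrite subnKC ?(ltnW TS)// => /(_ lS)[P [lP SP]].
rewrite subn_gt0 TS => /(_ isT) nP; suff -> : T = P by [].
by apply: (level_inj lT lP); exists x; split=> //; exact: SP.
Qed.

Lemma deeper_sub_child {S T : set X} : dyadic D S -> dyadic D T ->
  (depth D T < depth D S)%N -> S `&` T !=set0 ->
  S `<=` lchild D T \/ S `<=` rchild D T.
Proof.
move=> /level_depth lS /level_depth lT TS [x [Sx Tx]].
(* The ancestor is taken one level below [T]: its parent meets [T] at equal depth, hence is [T]. *)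
have := @ancestor (depth D T).+1 (depth D S - (depth D T).+1) S.
rewrite subnKC// => /(_ lS)[P [[Q [lQ nQ PQ]] SP _]].
have -> : T = Q.
  apply: (level_inj lT lQ); exists x; split=> //.
  exact/(child_sub nQ PQ)/SP.
by case: PQ => <-; [left|right].
Qed.

(** * Cells and the pieces they cut out of a dyadic set *)

Lemma cells_depth {n : nat} {C : set X} : cells D n C ->
  (depth D C <= n.+1)%N /\ (nonleaf D C -> depth D C = n.+1).
Proof. by move=> [_ [->//|[[_ nC] /leqW]]]. Qed.

(** If the depths differed, the shallower cell would be non-leaf, hence at depth [n.+1], which no
    cell exceeds. At equal depths [level_inj] applies. *)
Lemma cells_meet {n : nat} {C C' : set X} : cells D n C -> cells D n C' ->
  C `&` C' !=set0 -> C = C'.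
Proof.
move=> cC cC'; have dC := cC.1; have dC' := cC'.1.
have [le nl] := cells_depth cC; have [le' nl'] := cells_depth cC'.
case: (ltngtP (depth D C) (depth D C')) => [lt|lt|eqd] meet.
- rewrite setIC in meet.
  by move: (lt); rewrite (nl (deeper_nonleaf dC' dC lt meet)) ltnNge le'.
- by move: (lt); rewrite (nl' (deeper_nonleaf dC dC' lt meet)) ltnNge le.
- by apply: (level_inj (level_depth dC)) meet; rewrite eqd; exact: level_depth.
Qed.

Lemma pieces_cell {n : nat} {T : set X} : cells D n T ->
  pieces D n T = [set T].
Proof.
move=> cT; apply/seteqP; split=> [P [P0 [C cC eP]]|_ ->].
  by rewrite eP in P0 *; rewrite (cells_meet cC cT P0) setIid.
split; first exact: dyadic_nonempty cT.1.
by exists T => //; rewrite setIid.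
Qed.

(** A non-leaf cell has depth [n.+1], so [C] can neither equal [T] nor properly contain it; [C] is
    therefore strictly deeper than [T]. *)
Lemma cell_sub_child {n : nat} {C T : set X} : cells D n C -> nonleaf D T ->
  (depth D T <= n)%N -> C `&` T !=set0 ->
  C `<=` lchild D T \/ C `<=` rchild D T.
Proof.
move=> cC nT Tn meet; have dC := cC.1; have dT := nonleaf_dyadic nT.
have [_ nl] := cells_depth cC.
have TnC : nonleaf D C -> (depth D T < depth D C)%N by move=> /nl ->.
case: (ltngtP (depth D T) (depth D C)) => [lt|lt|eqd].
- exact: deeper_sub_child.
- rewrite setIC in meet.
  by have := TnC (deeper_nonleaf dT dC lt meet); rewrite ltnNge ltnW.
- have eCT : C = T.
    by apply: (level_inj (level_depth dC)) meet; rewrite -eqd; exact: level_depth.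
  by move: TnC; rewrite eCT ltnn => /(_ nT).
Qed.

Lemma children_disjoint {T : set X} {x : X} : nonleaf D T ->
  lchild D T x -> rchild D T x -> False.
Proof. by move=> nT Lx Rx; have : set0 x by rewrite -(childI nT). Qed.

(** A cell meeting [T] lies inside a single child, so cutting it by the child it meets or by [T]
    gives the same piece. *)
Lemma piece_child {n : nat} {C T H : set X} : cells D n C -> nonleaf D T ->
  (depth D T <= n)%N -> H = lchild D T \/ H = rchild D T ->
  C `&` H !=set0 -> C `&` H = C `&` T.
Proof.
move=> cC nT Tn HT [x [Cx Hx]]; have HsT := child_sub nT HT.
have meet : C `&` T !=set0 by exists x; split=> //; exact: HsT.
suff CH : C `<=` H by rewrite !setIidl//; exact: subset_trans HsT.
have [CL|CR] := cell_sub_child cC nT Tn meet; case: HT => HT; rewrite HT// in Hx *.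
  by case: (children_disjoint nT (CL _ Cx) Hx).
by case: (children_disjoint nT Hx (CR _ Cx)).
Qed.

Lemma pieces_nonleaf {n : nat} {T : set X} : nonleaf D T ->
  (depth D T <= n)%N ->
  pieces D n T = pieces D n (lchild D T) `|` pieces D n (rchild D T).
Proof.
move=> nT Tn; apply/seteqP; split=> [P [P0 [C cC eP]]|P].
  have [CL|CR] := cell_sub_child cC nT Tn (eq_ind _ _ P0 _ eP); [left|right];
    split=> //; exists C => //; rewrite eP.
  - by rewrite !setIidl//; apply: subset_trans CL (child_sub nT (or_introl erefl)).
  - by rewrite !setIidl//; apply: subset_trans CR (child_sub nT (or_intror erefl)).
by case=> -[P0 [C cC eP]]; split=> //; exists C => //; rewrite eP in P0 *;
  apply: (piece_child cC nT Tn _ P0); by [left|right].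
Qed.

Lemma pieces_disjoint (n : nat) (T : set X) : nonleaf D T ->
  [disjoint pieces D n (lchild D T) & pieces D n (rchild D T)].
Proof.
move=> nT; apply/disj_setPS => P [[[x Px] [C _ eC]] [_ [C' _ eC']]].
have [_ Lx] : (C `&` lchild D T) x by rewrite -eC.
have [_ Rx] : (C' `&` rchild D T) x by rewrite -eC'.
exact: children_disjoint Lx Rx.
Qed.

End tree.

(** * Haar factors and their finite products along a branch *)

Section product.
Context {R : realType} {X : Type} (D : dyadic_system X) (a : set X -> R).

Lemma haar_lchild (S : set X) (x : X) : lchild D S x -> haar R D S x = 1.
Proof. by move=> Lx; rewrite /haar mem_set. Qed.

Lemma haar_rchild (S : set X) (x : X) : nonleaf D S -> rchild D S x ->
  haar R D S x = -1.
Proof.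
move=> nS Rx; rewrite /haar memNset ?mem_set// => Lx.
exact: children_disjoint Lx Rx.
Qed.

Lemma haar_out (S : set X) (x : X) : nonleaf D S -> ~ S x -> haar R D S x = 0.
Proof.
move=> nS Sx; rewrite /haar !memNset// => cx; apply: Sx.
  exact: child_sub nS (or_intror erefl) _ cx.
exact: child_sub nS (or_introl erefl) _ cx.
Qed.

(* The strict variant of [partial_product]: its value on a dyadic set of depth
   k is the product over the proper ancestors of that set. *)
Definition product_below (k : nat) (x : X) : R :=
  \big[*%R/1]_(S \in [set S | nonleaf D S /\ (depth D S < k)%N])
    (1 + a S * haar R D S x).

Lemma product_below0 (x : X) : product_below 0 x = 1.
Proof. by rewrite /product_below fsbig1// => S []. Qed.

Lemma finite_level (n : nat) : finite_set (level D [set: X] n).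
Proof.
elim: n => [|n IH]; first exact: finite_set1.
apply: (@sub_finite_set _ _ (lchild D @` level D [set: X] n `|`
                             rchild D @` level D [set: X] n)).
  by move=> S [P [lP _ [->|->]]]; [left|right]; exists P.
by rewrite finite_setU; split; exact: finite_image.
Qed.

(** A finite index set is what allows a factor to be split off; a product with infinite support
    would take the default value 1. *)
Lemma finite_nonleaf_below (k : nat) :
  finite_set [set S | nonleaf D S /\ (depth D S < k)%N].
Proof.
apply: (@sub_finite_set _ _ (\bigcup_(n in `I_k) level D [set: X] n)).
  by move=> S [nS Sk]; exists (depth D S) => //; exact/level_depth/nonleaf_dyadic.
by apply: bigcup_finite => // n _; exact: finite_level.
Qed.

(** Below a leaf nothing more is multiplied in: a non-leaf set through [x] at the depth of [T] or
    deeper would make [T] non-leaf, so every extra factor is 1. *)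
Lemma product_below_leaf {k : nat} {x : X} {T : set X} : leaf D T -> T x ->
  (depth D T <= k)%N -> product_below k x = product_below (depth D T) x.
Proof.
move=> [dT nT] Tx Tk; apply/esym/fsbig_widen => [S [nS ST]|S [[nS _] ST]].
  by split=> //; exact: leq_trans Tk.
rewrite /preimage/= haar_out ?mulr0 ?addr0// => Sx; apply: ST; split=> //.
have dS := nonleaf_dyadic nS.
case: (ltngtP (depth D S) (depth D T)) => // [lt|eqd]; case: nT.
  by apply: (deeper_nonleaf dS dT lt); exists x.
suff -> : T = S by [].
apply: (level_inj (level_depth dT)); last by exists x.
by rewrite -eqd; exact: level_depth.
Qed.

(** Among the sets of the same depth as [T], only [T] contains [x]; the other new factors are 1. *)
Lemma product_belowS {x : X} {T : set X} : nonleaf D T -> T x ->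
  product_below (depth D T).+1 x =
  (1 + a T * haar R D T x) * product_below (depth D T) x.
Proof.
move=> nT Tx; rewrite {1}/product_below (fsbigD1 T)//=; last first.
  exact: finite_nonleaf_below.
congr (_ * _); apply/esym/fsbig_widen => [S [nS ST]|S [[[nS ST] neST] nST]].
  split; first by split=> //; exact: ltnW.
  by move=> eST; rewrite eST ltnn in ST.
rewrite /preimage/= haar_out ?mulr0 ?addr0// => Sx.
have eqd : depth D S = depth D T.
  move: ST; rewrite /= ltnS leq_eqVlt => /orP[/eqP//|lt].
  by case: nST.
apply: neST; apply: (level_inj (level_depth (nonleaf_dyadic nS))).
  by rewrite eqd; exact/level_depth/nonleaf_dyadic.
by exists x.
Qed.

Lemma product_below_lchild {x : X} {T : set X} : nonleaf D T -> lchild D T x ->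
  product_below (depth D (lchild D T)) x =
  (1 + a T) * product_below (depth D T) x.
Proof.
move=> nT Lx; rewrite (depth_child nT (or_introl erefl)) product_belowS//.
  by rewrite haar_lchild// mulr1.
exact: child_sub nT (or_introl erefl) _ Lx.
Qed.

Lemma product_below_rchild {x : X} {T : set X} : nonleaf D T -> rchild D T x ->
  product_below (depth D (rchild D T)) x =
  (1 - a T) * product_below (depth D T) x.
Proof.
move=> nT Rx; rewrite (depth_child nT (or_intror erefl)) product_belowS//.
  by rewrite haar_rchild// mulrN1.
exact: child_sub nT (or_intror erefl) _ Rx.
Qed.

Lemma product_below_const (T : set X) : dyadic D T -> forall x y, T x -> T y ->
  product_below (depth D T) x = product_below (depth D T) y.
Proof.
move: T; apply: dyadic_ind => [x y _ _|T nT IH].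
  by rewrite (@depthE _ _ 0)// !product_below0.
split=> x y cx cy.
  by rewrite !product_below_lchild// (IH x y)//;
    exact: child_sub nT (or_introl erefl) _ _.
by rewrite !product_below_rchild// (IH x y)//;
    exact: child_sub nT (or_intror erefl) _ _.
Qed.

(** * Integrals of the partial products *)

Lemma partial_product_cell {n : nat} {C : set X} {x : X} : cells D n C -> C x ->
  partial_product D a n x = product_below (depth D C) x.
Proof.
(* At depth [n.+1] the two products coincide by computation, since [k <= n] and [k < n.+1] are
   convertible. *)
move=> [dC] [->//|[lC Cn]] Cx.
by rewrite -(product_below_leaf lC Cx (leqW Cn)).
Qed.

Lemma simple_integral_cell {n : nat} {C : set X} {x : X} : cells D n C -> C x ->
  simple_integral D (naive R D) n (partial_product D a n) C =
  product_below (depth D C) x * naive R D C.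
Proof.
move=> cC Cx; rewrite /simple_integral (pieces_cell cC) fsbig_set1.
(* Whichever value [xget] selects, it is the constant value on the cell; the default 0 is excluded
   because [x] witnesses a value. *)
congr (_ * _); case: xgetP => [_ _ [y Cy <-]|/(_ (partial_product D a n x))[]].
  by rewrite (partial_product_cell cC Cy); exact: product_below_const cC.1 _ _ Cy Cx.
by exists x.
Qed.

(** Finiteness of the pieces is proved in the same induction, because splitting the sum over a union
    requires it. *)
Lemma simple_integral_partial_product (n : nat) (T : set X) : dyadic D T ->
  (depth D T <= n.+1)%N -> finite_set (pieces D n T) /\
  forall x, T x -> simple_integral D (naive R D) n (partial_product D a n) T =
                   product_below (depth D T) x * naive R D T.
Proof.
have cellP U : cells D n U -> finite_set (pieces D n U) /\
    forall x, U x -> simple_integral D (naive R D) n (partial_product D a n) U =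
                     product_below (depth D U) x * naive R D U.
  move=> cU; split=> [|x Ux]; last exact: simple_integral_cell.
  by rewrite (pieces_cell cU); exact: finite_set1.
(* Induction on the number [j] of levels between [T] and depth [n.+1], from the cells upwards; a
   leaf met earlier is already a cell. *)
move=> dT Tn; move: (n.+1 - depth D T)%N (subnKC Tn) => j.
elim: j T dT {Tn} => [|j IH] T dT.
  by rewrite addn0 => Tn; apply: cellP; split=> //; left.
rewrite addnS => -[eTn]; have Tn : (depth D T <= n)%N by rewrite -eTn leq_addr.
have [nT|nT] := pselect (nonleaf D T); last first.
  by apply: cellP; split=> //; right.
have [|finL intL] := IH _ (lchild_dyadic nT).
  by rewrite (depth_child nT (or_introl erefl)) addSn eTn.
have [|finR intR] := IH _ (rchild_dyadic nT).
  by rewrite (depth_child nT (or_intror erefl)) addSn eTn.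
rewrite /simple_integral (pieces_nonleaf nT Tn); split.
  by rewrite finite_setU.
move=> x Tx; have disj := pieces_disjoint n T nT.
rewrite fsbigU0//; last by move/disj_set2P: disj => ->.
(* Sample points [y] and [z] evaluate the two halves; constancy on [T] brings both values back to
   [x], and the factors [(1 + a T) / 2] and [(1 - a T) / 2] add up to 1. *)
have [y Ly] := dyadic_nonempty (lchild_dyadic nT).
have [z Rz] := dyadic_nonempty (rchild_dyadic nT).
rewrite -!/(simple_integral _ _ _ _ _) (intL y Ly) (intR z Rz).
rewrite product_below_lchild// product_below_rchild// naive_lchild// naive_rchild//.
rewrite (product_below_const T dT y x)//; last
  exact: child_sub nT (or_introl erefl) _ Ly.
rewrite (product_below_const T dT z x)//; last
  exact: child_sub nT (or_intror erefl) _ Rz.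
by rewrite /=; field.
Qed.

(** * The limit measure and its recursion *)

Context (m : R).

Lemma partial_product_measure_cvg (S : set X) (x : X) : dyadic D S -> S x ->
  (fun n => partial_product_measure D m a n S) @ \oo -->
    m * (product_below (depth D S) x * naive R D S).
Proof.
move=> dS Sx; apply: cvg_near_cst; near=> n.
rewrite /partial_product_measure; congr (_ * _).
have [|_ intS] := simple_integral_partial_product n S dS; last exact: intS.
(* The sequence is constant from [n = depth D S] on. *)
by apply: leqW; near: n; exact: nbhs_infty_ge.
Unshelve. all: by end_near. Qed.

Lemma product_measureE {S : set X} {x : X} : dyadic D S -> S x ->
  product_measure D m a S = m * (product_below (depth D S) x * naive R D S).
Proof.
by move=> dS Sx; apply/cvg_lim => //; exact: partial_product_measure_cvg.
Qed.

Lemma product_measure_root : product_measure D m a [set: X] = m.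
Proof.
have [x _] := dyadic_nonempty (dyadic_root D).
rewrite (product_measureE (dyadic_root D) (I : [set: X] x)) naive_root.
by rewrite (@depthE _ _ 0)// product_below0 !mulr1.
Qed.

Lemma product_measure_lchild (S : set X) : nonleaf D S ->
  product_measure D m a (lchild D S) =
  2^-1 * (1 + a S) * product_measure D m a S.
Proof.
move=> nS; have [x Lx] := dyadic_nonempty (lchild_dyadic nS).
have Sx : S x by exact: child_sub nS (or_introl erefl) _ Lx.
rewrite (product_measureE (lchild_dyadic nS) Lx).
rewrite (product_measureE (nonleaf_dyadic nS) Sx).
by rewrite product_below_lchild// naive_lchild//; ring.
Qed.

Lemma product_measure_rchild (S : set X) : nonleaf D S ->
  product_measure D m a (rchild D S) =
  2^-1 * (1 - a S) * product_measure D m a S.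
Proof.
move=> nS; have [x Rx] := dyadic_nonempty (rchild_dyadic nS).
have Sx : S x by exact: child_sub nS (or_intror erefl) _ Rx.
rewrite (product_measureE (rchild_dyadic nS) Rx).
rewrite (product_measureE (nonleaf_dyadic nS) Sx).
by rewrite product_below_rchild// naive_rchild//; ring.
Qed.

(** Convergence and additivity hold for arbitrary real parameters; only nonnegativity depends on
    their range and is left to the caller. *)
Lemma product_measure_limit :
  (forall S, dyadic D S -> 0 <= product_measure D m a S) ->
  is_weak_star_limit D (partial_product_measure D m a) (product_measure D m a).
Proof.
move=> pm0; split; first split=> // S nS.
  by rewrite product_measure_lchild// product_measure_rchild//; field.
move=> S dS; have [x Sx] := dyadic_nonempty dS.
by rewrite (product_measureE dS Sx); exact: partial_product_measure_cvg.
Qed.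

End product.

(** * The three claims, by induction down the tree *)

Theorem lemma3p1 (R : realType) (X : Type) (D : dyadic_system X) :
  (forall mu a : set X -> R,
     positive_measure D mu -> product_coefficients D mu a ->
     is_weak_star_limit D (partial_product_measure D (mu [set: X]) a)
                          (product_measure D (mu [set: X]) a) /\
     measure_eq D mu (product_measure D (mu [set: X]) a)) /\
  (forall (a : set X -> R) (m : R),
     (forall S, nonleaf D S -> -1 < a S < 1) -> 0 < m ->
     [/\ is_weak_star_limit D (partial_product_measure D m a)
                              (product_measure D m a),
         forall S, dyadic D S -> 0 < product_measure D m a S,
         product_coefficients D (product_measure D m a) a
       & product_measure D m a [set: X] = m]) /\
  (forall (a : set X -> R) (m : R),
     (forall S, nonleaf D S -> -1 <= a S <= 1) -> 0 < m ->
     [/\ is_weak_star_limit D (partial_product_measure D m a)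
                              (product_measure D m a),
         positive_measure D (product_measure D m a),
         product_measure D m a [set: X] = m
       & zero_convention D (product_measure D m a) a ->
         product_coefficients D (product_measure D m a) a]).
Proof.
split; [|split].
- move=> mu a [[mu0 _] _] coef.
  (* Both measures have the same root mass and obey the same recursion on children. *)
  have muE : measure_eq D mu (product_measure D (mu [set: X]) a).
    apply: dyadic_ind; first by rewrite product_measure_root.
    move=> S nS IH; have [muL muR _] := coef S nS.
    by rewrite muL muR IH product_measure_lchild// product_measure_rchild.
  split=> //; apply: product_measure_limit => S dS.
  by rewrite -muE//; exact: mu0.
- move=> a m a1 m0.
  have pm0 : forall S, dyadic D S -> 0 < product_measure D m a S.
    apply: dyadic_ind; first by rewrite product_measure_root.
    move=> S nS IH; have /andP[aN1 a1S] := a1 S nS.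
    rewrite product_measure_lchild// product_measure_rchild//.
    by split; rewrite !mulr_gt0 ?invr_gt0//; lra.
  split=> //.
  + by apply: product_measure_limit => S /pm0/ltW.
  + move=> S nS; split; first exact: product_measure_lchild.
      exact: product_measure_rchild.
    by move=> z; have := pm0 S (nonleaf_dyadic nS); rewrite z ltxx.
  + exact: product_measure_root.
- move=> a m a1 m0.
  have pm0 : forall S, dyadic D S -> 0 <= product_measure D m a S.
    apply: dyadic_ind; first by rewrite product_measure_root ltW.
    move=> S nS IH; have /andP[aN1 a1S] := a1 S nS.
    rewrite product_measure_lchild// product_measure_rchild//.
    by split; rewrite !mulr_ge0 ?invr_ge0//; lra.
  have lim := product_measure_limit D a m pm0.
  split=> //.
  + by split; [exact: lim.1|rewrite product_measure_root].
  + exact: product_measure_root.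
  + move=> zero S nS; split; first exact: product_measure_lchild.
      exact: product_measure_rchild.
    (* A null set [S] is not the root, whose mass is [m > 0]. So it is a half of some [P], and the
       convention at [P] gives [a S = 0], as [S] is its own descendant at level 0. *)
    move=> muS0; have [[|n] lS] := dyadic_finite_depth (nonleaf_dyadic nS).
      by move: muS0 m0; rewrite lS product_measure_root => ->; rewrite ltxx.
    case: lS => P [_ nP SP].
    by apply: (zero P S nP SP muS0) => //; exists 0%N.
Qed.
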